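(* Let $K\subset\mathbb{R}$ be a (non-singleton) self-similar set that satisfies the strong separation condition, and let $m\in\mathbb{N}$. Then the set $$\Big\{(t_1,\ldots,t_m)\in\mathbb{R}^m:\ 0=t_0<t_1<\cdots<t_m,\ \text{and}\ \bigcup_{j=0}^m(K+t_j)\ \text{is a self-similar set}\Big\}$$ is at most countable.
   Context: $\mathbb{N}=\{1,2,\ldots\}$. A self-similar IFS on $\mathbb{R}$ is a finite set of maps $f_i(x)=\lambda_i x+a_i$, $1\le i\le\ell$, with $0<|\lambda_i|<1$, $a_i\in\mathbb{R}$; its attractor is the unique non-empty compact set $K\subset\mathbb{R}$ with $K=\bigcup_{i=1}^\ell f_i(K)$. The IFS satisfies the strong separation condition (SSC) if the sets $f_i(K)$, $1\le i\le\ell$, are pairwise disjoint. A self-similar set is the attractor of some self-similar IFS; it satisfies the SSC if it is the attractor of some self-similar IFS that satisfies the SSC. All self-similar sets under consideration are assumed to be non-singletons. *)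

(* Defs.v *)
From HB Require Import structures.
From mathcomp Require Import all_boot all_order all_algebra.
From mathcomp Require Import all_classical all_reals all_analysis.

Set Implicit Arguments.
Unset Strict Implicit.
Unset Printing Implicit Defensive.

Import Order.TTheory GRing.Theory Num.Theory.
Import numFieldNormedType.Exports.

Local Open Scope classical_set_scope.
Local Open Scope ring_scope.

(* The IFS {x |-> lam i * x + a i : i < l} on R is given by its ratios lam and
   its translations a. *)

Definition ifs_map (R : realType) (l : nat) (lam a : 'I_l -> R)
  (i : 'I_l) (x : R) : R := lam i * x + a i.

Definition is_ifs (R : realType) (l : nat) (lam a : 'I_l -> R) : Prop :=
  forall i : 'I_l, 0 < `|lam i| < 1.

(* The case l = 0 is harmless: an empty IFS has no non-empty invariant set. *)
Definition is_attractor (R : realType) (l : nat) (lam a : 'I_l -> R)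
  (K : set R) : Prop :=
  [/\ K !=set0, compact K & K = \bigcup_(i : 'I_l) (ifs_map lam a i @` K)].

Definition self_similar (R : realType) (K : set R) : Prop :=
  exists (l : nat) (lam a : 'I_l -> R), is_ifs lam a /\ is_attractor lam a K.

Definition self_similar_SSC (R : realType) (K : set R) : Prop :=
  exists (l : nat) (lam a : 'I_l -> R),
    [/\ is_ifs lam a, is_attractor lam a K
      & trivIset setT (fun i : 'I_l => ifs_map lam a i @` K)].

Definition is_singleton (T : Type) (A : set T) : Prop :=
  exists x : T, A = [set x].

Definition translate (R : realType) (K : set R) (s : R) : set R :=
  [set x + s | x in K].

(* Main.v *)
Require Import Defs.
From HB Require Import structures.
From mathcomp Require Import all_boot all_order all_algebra.
From mathcomp Require Import all_classical all_reals all_analysis.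
From mathcomp Require Import lra ring.

Set Implicit Arguments.
Unset Strict Implicit.
Unset Printing Implicit Defensive.

Import Order.TTheory GRing.Theory Num.Theory.
Import numFieldNormedType.Exports.

Local Open Scope classical_set_scope.
Local Open Scope ring_scope.

(** Write [f_w] for the composition of the maps of the IFS along a word [w],
    [|w|] for the absolute value of its ratio, and [delta] for the least
    distance between two different first-level pieces of [K].

    The core is that the set [G] of non-constant affine maps sending [K] into
    itself is countable.  It rests on a rigidity phenomenon
    ([near_identity_rigid]): an affine self-embedding of [K] that moves every
    point by less than [delta] preserves each first-level piece, so the orbits
    of points in two different pieces stay between [delta] and the diameter
    apart; hence the ratio has absolute value one, and the map is the identity.
    Conjugating by [f_w], two elements of [G] that are closer than [delta |w|] on
    [K] and whose images of [K] contain [f_w(K)] coincide.  Thus for each [w] the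
    maps [g] of [G] with [f_w(K)] inside [g(K)] are uniformly separated, and
    there are countably many of them.

    It remains to see that every [g] in [G] has such a [w]
    ([self_embedding_interior]).  This is a dimension argument.  Let [s] solve
    Moran's equation and give the cylinder [f_w(K)] the weight [|w|^s].  Any
    finite cover of [K] by cylinders has total weight at least one
    ([cover_weight_ge1]), so the covers of [g(K)] have total weight bounded below
    by a positive constant ([image_cover_weight]).  On the other hand, if [g(K)]
    contains no cylinder, then inside every cylinder it misses a subcylinder of
    bounded depth ([image_misses_cylinders]): otherwise renormalized copies
    [f_I^-1 g f_J] would accumulate at an affine map [h] with [K] inside [h(K)],
    and rigidity would make some renormalized copy equal to [h], so that [g(K)]
    would contain a cylinder after all.  Missing a subcylinder of bounded depth
    everywhere lets one cover [g(K)] with arbitrarily small weight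
    ([image_shrinks]), a contradiction.

    Finally let [x |-> r x + b] be one map of an IFS whose attractor is the union
    of the translates [K + t_j].  It sends each [K + t_j] into the union, and the
    pigeonhole principle [cylinder_in_closed_piece] gives [k(j)] and [w_j] such
    that [x |-> r (f_(w_j)(x) + t_j) + b - t_(k(j))] belongs to [G].  There are
    countably many choices for [k], for the words and for the elements of [G],
    and they determine [t]: they give [r] and the numbers [c_j] of the linear
    system [r t_j + b - t_(k(j)) = c_j], whose unknowns are [b] and the [t_j] and
    which has at most one solution with [t_0 = 0], because [0 < |r| < 1]
    ([translations_determined]). *)

(** * Preliminaries on real numbers *)

Section RealFacts.
Variable R : realType.

Lemma expr_lt_eps (c e : R) : 0 <= c < 1 -> 0 < e -> exists n, c ^+ n < e.
Proof.
move=> /andP[c0 c1] e0.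
have /cvgrPdist_lt/(_ e e0)[N _ /(_ N)/= HN] : GRing.exp c @ \oo --> (0 : R).
  by apply: cvg_expr; rewrite ger0_norm.
exists N; have := HN (leqnn N).
by rewrite sub0r normrN ger0_norm ?exprn_ge0.
Qed.

Lemma fin_pos_lower_bound (I : finType) (f : I -> R) :
  (forall i, 0 < f i) -> exists2 e, 0 < e <= 1 & forall i, e <= f i.
Proof.
move=> f0; exists (\big[Num.min/1]_i f i); last first.
  by move=> i; exact: bigmin_le_cond.
rewrite bigmin_le_id andbT.
by apply: lt_bigmin => // i _; exact: f0.
Qed.

Lemma bounded_pair_cluster_point (r c : nat -> R) (M : R) :
  (forall n, `|r n| <= M) -> (forall n, `|c n| <= M) ->
  exists rho b : R, forall e, 0 < e -> forall N, exists2 n, (N <= n)%N &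
    `|r n - rho| < e /\ `|c n - b| < e.
Proof.
have bnd (u : nat -> R) : (forall n, `|u n| <= M) -> bounded_fun u.
  move=> uM; exists M; split; first exact: num_real.
  by move=> x Mx n _; apply: le_trans (uM n) (ltW Mx).
move=> rM cM.
have [f finc /cvg_ex[rho frho]] := bolzano_weierstrass (bnd _ rM).
have [g ginc /cvg_ex[b gb]] :=
  bolzano_weierstrass (bnd (c \o f) (fun n => cM (f n))).
exists rho, b => e e0 N.
have /cvgrPdist_lt/(_ e e0)[N1 _ H1] := frho.
have /cvgrPdist_lt/(_ e e0)[N2 _ H2] := gb.
have incge (h : nat -> nat) : increasing_seq h -> forall n, (n <= h n)%N.
  move=> hinc; elim=> // n IH; apply: leq_ltn_trans IH _.
  have := hinc n.+1 n; rewrite !leEnat ltnn => /negbT.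
  by rewrite -ltnNge.
pose k := maxn N (maxn N1 N2).
have gk : (k <= g k)%N by apply: incge.
have fgk : (g k <= f (g k))%N by apply: incge.
exists (f (g k)).
  by apply: leq_trans fgk; apply: leq_trans gk; exact: leq_maxl.
split; rewrite distrC.
  apply: H1 => /=; apply: leq_trans gk.
  by rewrite /k !leq_max leqnn orbT.
by apply: H2 => /=; rewrite /k !leq_max leqnn !orbT.
Qed.

(** The sum of the powers exceeds one at exponent 0, as there are two ratios,
    and tends to 0, so it crosses one at a positive exponent. *)
Lemma similarity_dimension_exists (l : nat) (lam : 'I_l -> R) (i j : 'I_l) :
  i != j -> (forall k, 0 < `|lam k| < 1) ->
  exists2 s : R, 0 < s & \sum_k `|lam k| `^ s = 1.
Proof.
move=> ij lam01.
pose F (s : R) : R := \sum_k expR (s * ln `|lam k|).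
have FE s : \sum_k `|lam k| `^ s = F s.
  apply: eq_bigr => k _; rewrite /powR ifF //.
  by have /andP[/gt_eqF] := lam01 k.
have Fcont : continuous F.
  apply: continuous_big => [|k _ s]; first exact: add_continuous.
  apply: continuous_cvg; first exact: continuous_expR.
  by apply: cvgM; [exact: cvg_id|exact: cvg_cst].
have F0 : 1 < F 0.
  rewrite /F (eq_bigr (fun=> 1)) => [|k _]; last by rewrite mul0r expR0.
  rewrite (bigD1 i) //= (bigD1 j) 1?eq_sym //= addrA.
  rewrite ltr_wpDr ?sumr_ge0 //; lra.
have lam_gap k : 0 < 1 - `|lam k| by have /andP[] := lam01 k; lra.
have [e /andP[e0 e1] He] := fin_pos_lower_bound lam_gap.
have [n Hn] : exists n, (1 - e) ^+ n < (l%:R + 1)^-1.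
  apply: expr_lt_eps; first by lra.
  by rewrite invr_gt0 ltr_wpDl.
have Fn : F n%:R < 1.
  rewrite -FE; apply: (@le_lt_trans _ _ (\sum_(k < l) (l%:R + 1)^-1)).
    apply: ler_sum => k _; rewrite powR_mulrn //.
    apply: le_trans (ltW Hn); apply: lerXn2r; rewrite ?nnegrE //; first lra.
    have := He k; lra.
  rewrite sumr_const card_ord -[_ *+ l]mulr_natl ltr_pdivrMr ?mul1r; last first.
    by rewrite ltr_wpDl.
  lra.
have [|||s] := @IVT _ F 0 n%:R 1.
- exact: ler0n.
- by apply: continuous_subspaceT.
- by rewrite min_r ?max_l; lra.
rewrite in_itv /= => /andP[s0 _] Fs.
exists s; last by rewrite FE.
rewrite lt_neqAle s0 andbT; apply/eqP => s00; move: Fs F0; rewrite -s00 => ->.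
by rewrite ltxx.
Qed.

End RealFacts.

(** * Attractors: letters, bounds and gaps *)

Section Attractor.
Variables (R : realType) (l : nat) (lam a : 'I_l -> R) (K : set R).
Hypothesis lam_lt1 : is_ifs lam a.
Hypothesis K_attractor : is_attractor lam a K.
Hypothesis K_separated : trivIset setT (fun i => ifs_map lam a i @` K).
Hypothesis K_many : ~ is_singleton K.

Local Notation f := (ifs_map lam a).

Lemma ifs_map_in i x : K x -> K (f i x).
Proof. by move=> Kx; case: K_attractor => _ _ ->; exists i => //; exists x. Qed.

Lemma ifs_map_preimage y : K y -> exists i, exists2 x, K x & f i x = y.
Proof.
by case: K_attractor => _ _ {1}-> [i _ [x Kx xy]]; exists i, x.
Qed.

Lemma ratio_bound : exists2 r : R, 0 < r < 1 & forall i, `|lam i| <= r.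
Proof.
have H i : 0 < 1 - `|lam i| by have /andP[] := lam_lt1 i; lra.
have [e e01 He] := fin_pos_lower_bound H.
exists (1 - e / 2); first lra.
by move=> i; have := He i; lra.
Qed.

Lemma attractor_bound : exists2 D : R, 0 < D & forall x, K x -> `|x| <= D.
Proof.
case: K_attractor => _ /compact_bounded [M [_ HM]] _.
exists (`|M| + 1); first by rewrite ltr_wpDl.
by move=> x Kx; apply: HM => //; have := ler_norm M; lra.
Qed.

Lemma attractor_closed y :
  (forall e, 0 < e -> exists2 x, K x & `|x - y| < e) -> K y.
Proof.
move=> H; case: K_attractor => _ Kc _.
apply: (compact_closed _ Kc); first exact: Rhausdorff.
move=> B /nbhs_ballP[e /= e0 eB].
have [x Kx xy] := H e e0; exists x; split=> //.
by apply: eB; rewrite /ball /= distrC.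
Qed.

Lemma attractor_two_points : exists x y, [/\ K x, K y & x != y].
Proof.
case: K_attractor => -[x Kx] _ _; apply: contrapT => H; apply: K_many.
exists x; apply/seteqP; split=> [y Ky /=|y ->//].
by apply/eqP/negPn/negP => yx; apply: H; exists y, x.
Qed.

(** With a single map, the diameter of [K] would shrink to 0 under iteration. *)
Lemma two_letters : exists i j : 'I_l, i != j.
Proof.
apply: contrapT => H.
have same i j : i = j :> 'I_l.
  by apply/eqP/negPn/negP => ij; apply: H; exists i, j.
have [x [y [Kx Ky xy]]] := attractor_two_points.
have [r r01 lamr] := ratio_bound.
have [D D0 KD] := attractor_bound.
have small n : forall u v, K u -> K v -> `|u - v| <= r ^+ n * (2 * D).
  elim: n => [|n IH] u v Ku Kv.
    rewrite expr0 mul1r; apply: le_trans (ler_normB _ _) _.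
    have := KD u Ku; have := KD v Kv; lra.
  have [i [u' Ku' <-]] := ifs_map_preimage Ku.
  have [j [v' Kv' <-]] := ifs_map_preimage Kv.
  rewrite (same j i) /ifs_map.
  have -> : lam i * u' + a i - (lam i * v' + a i) = lam i * (u' - v') by ring.
  rewrite normrM exprS -mulrA.
  by apply: ler_pM => //; exact: IH.
have xy0 : 0 < `|x - y| by rewrite normr_gt0 subr_eq0.
have D20 : 0 < 2 * D by lra.
have [|n Hn] := @expr_lt_eps R r (`|x - y| / (2 * D)) _ (divr_gt0 xy0 D20).
  lra.
have := small n x y Kx Ky; rewrite leNgt; apply/negP/negPn.
by rewrite -ltr_pdivlMr //; lra.
Qed.

(** Disjoint compact pieces are at positive distance, and there are finitely
    many pairs of pieces. *)
Lemma gap_exists : exists2 delta : R, 0 < delta &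
  forall i j x y, i != j -> K x -> K y -> delta <= `|f i x - f j y|.
Proof.
have pair (p : 'I_l * 'I_l) : exists d : R, 0 < d /\
    (p.1 != p.2 -> forall x y, K x -> K y -> d <= `|f p.1 x - f p.2 y|).
  case: p => i j /=; have [<-|ij] := eqVneq i j; first by exists 1; split.
  case: K_attractor => -[x0 Kx0] Kc _.
  pose g (z : R * R) := `|f i z.1 - f j z.2|.
  have gc : continuous g.
    move=> z; rewrite /g; apply: cvg_norm; apply: cvgB; apply: cvgD.
    - by apply: cvgM; [exact: cvg_cst|exact: cvg_fst].
    - exact: cvg_cst.
    - by apply: cvgM; [exact: cvg_cst|exact: cvg_snd].
    - exact: cvg_cst.
  have ne : (K `*` K) !=set0 by exists (x0, x0).
  have [|[u v]] := compact_EVT_min ne (compact_setX Kc Kc) (f := g).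
    exact: continuous_subspaceT.
  rewrite inE => -[/= Ku Kv] Hmin.
  exists (g (u, v)); split; last first.
    by move=> _ x y Kx Ky; apply: (Hmin (x, y)); rewrite inE.
  rewrite normr_gt0 subr_eq0; apply/eqP => e.
  have /eqP := ij; apply; apply: (K_separated (i := i) (j := j)) => //.
  by exists (f i u); split; [exists u|exists v].
have [d Hd] := choice pair.
have [e /andP[e0 _] He] := fin_pos_lower_bound (fun p => (Hd p).1).
exists e => // i j x y ij Kx Ky.
exact: le_trans (He (i, j)) ((Hd (i, j)).2 ij _ _ Kx Ky).
Qed.

End Attractor.

(** * Words and cylinders *)

Section Words.
Variables (R : realType) (l : nat) (lam a : 'I_l -> R) (K : set R).
Hypothesis lam_lt1 : is_ifs lam a.
Hypothesis K_attractor : is_attractor lam a K.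
Local Notation f := (ifs_map lam a).

Definition word_map (w : seq 'I_l) (x : R) : R := foldr f x w.

Definition word_ratio (w : seq 'I_l) : R := \prod_(i <- w) lam i.

Definition cylinder (w : seq 'I_l) : set R := word_map w @` K.

Lemma word_map_cat w v x : word_map (w ++ v) x = word_map w (word_map v x).
Proof. exact: foldr_cat. Qed.

Lemma word_ratio_cons i w : word_ratio (i :: w) = lam i * word_ratio w.
Proof. exact: big_cons. Qed.

Lemma word_ratio_cat w v : word_ratio (w ++ v) = word_ratio w * word_ratio v.
Proof. exact: big_cat. Qed.

Lemma word_mapE w x : word_map w x = word_ratio w * x + word_map w 0.
Proof.
elim: w => [|i w IH]; first by rewrite /word_ratio big_nil mul1r addr0.
by rewrite word_ratio_cons /= IH /ifs_map mulrDr mulrA addrA.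
Qed.

Lemma word_mapB w x y : word_map w x - word_map w y = word_ratio w * (x - y).
Proof. by rewrite word_mapE (word_mapE w y); ring. Qed.

Lemma word_ratio_gt0 w : 0 < `|word_ratio w|.
Proof.
elim: w => [|i w IH]; first by rewrite /word_ratio big_nil normr1.
by rewrite word_ratio_cons normrM mulr_gt0 //; have /andP[] := lam_lt1 i.
Qed.

Lemma word_ratio_neq0 w : word_ratio w != 0.
Proof. by rewrite -normr_gt0 word_ratio_gt0. Qed.

Lemma word_ratio_le_expr (r : R) w : (forall i, `|lam i| <= r) ->
  `|word_ratio w| <= r ^+ size w.
Proof.
move=> lamr; elim: w => [|i w IH]; first by rewrite /word_ratio big_nil normr1.
by rewrite word_ratio_cons normrM exprS ler_pM.
Qed.

Lemma word_map_inj w : injective (word_map w).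
Proof.
move=> x y /eqP; rewrite -subr_eq0 word_mapB mulf_eq0.
by rewrite (negbTE (word_ratio_neq0 w)) subr_eq0 => /eqP.
Qed.

Lemma word_map_in w x : K x -> K (word_map w x).
Proof. by move=> Kx; elim: w => //= i w; exact: (ifs_map_in K_attractor). Qed.

Lemma cylinder_sub w : cylinder w `<=` K.
Proof. by move=> _ [x Kx <-]; exact: word_map_in. Qed.

Lemma word_of_point n y : K y -> exists2 w, size w = n & cylinder w y.
Proof.
elim: n y => [|n IH] y Ky; first by exists [::] => //; exists y.
have [i [x Kx <-]] := ifs_map_preimage K_attractor Ky.
have [w <- [z Kz <-]] := IH x Kx.
by exists (i :: w) => //; exists z.
Qed.

Section Gap.
Variable delta : R.
Hypothesis delta_gt0 : 0 < delta.
Hypothesis gap : forall i j x y, i != j -> K x -> K y ->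
  delta <= `|f i x - f j y|.

Lemma same_letter i j x y : K x -> K y -> `|f i x - f j y| < delta -> i = j.
Proof.
move=> Kx Ky; case: (eqVneq i j) => // ij.
by rewrite ltNge (gap ij Kx Ky).
Qed.

Lemma same_letter_eq i j x y : K x -> K y -> f i x = f j y -> i = j.
Proof.
by move=> Kx Ky e; apply: (same_letter Kx Ky); rewrite e subrr normr0.
Qed.

(** A cylinder is isolated in [K] at the scale of its own ratio. *)
Lemma cylinder_isolated w x y : cylinder w x -> K y ->
  `|x - y| < delta * `|word_ratio w| -> cylinder w y.
Proof.
move=> [z Kz <-]; elim: w y => [|i w IH] y Ky; first by exists y.
have [j [t Kt <-]] := ifs_map_preimage K_attractor Ky.
move: Kt; rewrite word_ratio_cons normrM /= => Kt lt.
have Kwz : K (word_map w z) by exact: word_map_in.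
have /andP[li0 li1] := lam_lt1 i.
have ij : i = j.
  apply: (same_letter Kwz Kt); apply: (lt_le_trans lt).
  rewrite ger_pMr // mulr_ile1 //; first exact: ltW.
  by rewrite (le_trans (word_ratio_le_expr w (fun k => ltW (andP (lam_lt1 k)).2)))
    // expr1n.
subst j; move: lt; rewrite /ifs_map.
have -> : lam i * word_map w z + a i - (lam i * t + a i) =
  lam i * (word_map w z - t) by ring.
rewrite normrM mulrCA ltr_pM2l // => /(IH _ Kt)[u Ku <-].
by exists u.
Qed.

(** A subset of [K] of diameter less than [delta * r] lies in a cylinder of
    ratio at most [r]: as long as [r < 1], the subset lies in one first-level
    piece, and pulling it back by that piece multiplies [r] by a factor bounded
    below by a constant greater than one. *)
Lemma small_set_in_cylinder (B : set R) (r : R) : B `<=` K -> 0 < r ->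
  (forall x y, B x -> B y -> `|x - y| < delta * r) ->
  exists2 w, B `<=` cylinder w & `|word_ratio w| <= r.
Proof.
move=> BK r0; have [q q01 lamq] := ratio_bound lam_lt1.
have [n nr] := expr_lt_eps (c := q) (ltac:(lra)) r0.
elim: n r r0 B BK nr => [|n IH] r r0 B BK nr Bsmall.
  exists [::]; last by rewrite /word_ratio big_nil normr1 ltW.
  by move=> x /BK Kx; exists x.
have [r1|r1] := leP 1 r.
  exists [::]; last by rewrite /word_ratio big_nil normr1.
  by move=> x /BK Kx; exists x.
(* an empty B is allowed, and then any letter does *)
have [i Bi] : exists i, forall x, B x -> exists2 z, K z & f i z = x.
  have [[x Bx]|nB] := pselect (B !=set0).
    have [i [z Kz zx]] := ifs_map_preimage K_attractor (BK x Bx).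
    exists i => y By; have [j [t Kt ty]] := ifs_map_preimage K_attractor (BK y By).
    exists t => //; rewrite -ty; congr (f _ t).
    apply: (same_letter Kz Kt); rewrite zx ty; apply: lt_trans (Bsmall _ _ Bx By) _.
    by rewrite gtr_pMr.
  have [[x Kx] _ _] := K_attractor.
  have [i _] := ifs_map_preimage K_attractor Kx.
  by exists i => y By; exfalso; apply: nB; exists y.
have /andP[li0 li1] := lam_lt1 i.
have [||||w Bw wr] := IH (r / `|lam i|) _ [set z | K z /\ B (f i z)].
- exact: divr_gt0.
- by move=> z [].
- rewrite ltr_pdivlMr //; apply: le_lt_trans nr.
  by rewrite exprSr ler_wpM2l // exprn_ge0 //; lra.
- move=> x y [_ Bx] [_ By]; have := Bsmall _ _ Bx By; rewrite /ifs_map.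
  have -> : lam i * x + a i - (lam i * y + a i) = lam i * (x - y) by ring.
  by rewrite normrM mulrA ltr_pdivlMr // mulrC.
exists (i :: w); last first.
  by rewrite word_ratio_cons normrM mulrC -ler_pdivlMr.
move=> x Bx; have [z Kz zx] := Bi x Bx.
have [|t Kt tz] := Bw z; first by split=> //; rewrite zx.
by exists t => //=; rewrite tz.
Qed.

(** * Weights of finite covers by cylinders *)

Section Weight.
Variable s : R.
Hypothesis s_gt0 : 0 < s.
Hypothesis moran : \sum_i `|lam i| `^ s = 1.

Definition weight (w : seq 'I_l) : R := `|word_ratio w| `^ s.

Lemma weight_cat w v : weight (w ++ v) = weight w * weight v.
Proof. by rewrite /weight word_ratio_cat normrM powRM. Qed.

Lemma weight_cons i w : weight (i :: w) = `|lam i| `^ s * weight w.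
Proof. by rewrite /weight word_ratio_cons normrM powRM. Qed.

Lemma weight_nil : weight [::] = 1.
Proof. by rewrite /weight /word_ratio big_nil normr1 powR1. Qed.

Lemma weight_ge0 w : 0 <= weight w.
Proof. exact: powR_ge0. Qed.

Definition covers (S : seq (seq 'I_l)) (B : set R) : Prop :=
  forall x, B x -> exists2 w, w \in S & cylinder w x.

Definition total_weight (S : seq (seq 'I_l)) : R := \sum_(w <- S) weight w.

(** The covers induced on the first-level pieces: a cover of [K] without the
    empty word restricts on [f_i(K)] to the words that start with [i]. *)
Definition tails (i : 'I_l) (S : seq (seq 'I_l)) : seq (seq 'I_l) :=
  [seq behead w | w <- S & ohead w == Some i].

Lemma total_weight_tails S :
  \sum_i `|lam i| `^ s * total_weight (tails i S) <= total_weight S.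
Proof.
rewrite /total_weight; elim: S => [|[|j w] S IH].
- rewrite [leRHS]big_nil big1 // => i _.
  by rewrite /tails /= big_nil mulr0.
- by rewrite big_cons weight_nil; apply: le_trans IH _; rewrite lerDr.
rewrite big_cons.
rewrite (eq_bigr (fun i => (if i == j then weight (j :: w) else 0) +
    `|lam i| `^ s * \sum_(v <- tails i S) weight v)); last first.
  move=> i _; rewrite /tails /= -[Some j == _]/(j == i) eq_sym.
  case: eqVneq => [->|_]; last by rewrite add0r.
  by rewrite big_cons mulrDr weight_cons.
rewrite big_split /= -big_mkcond big_pred1_eq lerD2l.
exact: IH.
Qed.

(** The weights behave like the masses of a self-similar probability measure:
    by separation a cover of [K] splits into covers of the first-level pieces,
    and Moran's equation adds up the resulting lower bounds. *)
Lemma cover_weight_ge1 S : covers S K -> 1 <= total_weight S.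
Proof.
have [n] : exists n, all (fun w => (size w <= n)%N) S.
  exists (\max_(w <- S) size w)%N; apply/allP => w wS.
  exact: leq_bigmax_seq.
elim: n S => [|n IH] S Sn cov.
  have [[x Kx] _ _] := K_attractor.
  have [w wS _] := cov x Kx.
  have := allP Sn w wS; rewrite leqn0 size_eq0 => /eqP w0; subst w.
  rewrite /total_weight (big_rem _ wS) /= weight_nil lerDl.
  by apply: sumr_ge0 => v _; exact: weight_ge0.
have [nilS|nilS] := boolP ([::] \in S).
  rewrite /total_weight (big_rem _ nilS) /= weight_nil lerDl.
  by apply: sumr_ge0 => v _; exact: weight_ge0.
apply: le_trans (total_weight_tails S); rewrite -[leLHS]moran.
apply: ler_sum => i _; rewrite ler_peMr ?powR_ge0 //; apply: IH.
  apply/allP => _ /mapP[w + ->]; rewrite mem_filter => /andP[_ /(allP Sn)].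
  by case: w.
move=> x Kx; have [w wS [z Kz zx]] := cov _ (ifs_map_in K_attractor i Kx).
case: w wS zx nilS => [->//|j w] wS /= zx _.
have Kwz : K (word_map w z) by exact: word_map_in.
have ji := same_letter_eq Kwz Kx zx; subst j.
exists w; first by apply/mapP; exists (i :: w); rewrite // mem_filter /= eqxx.
exists z => //; move: zx; rewrite /ifs_map => /addIr /mulfI; apply.
by have /andP[] := lam_lt1 i; rewrite normr_gt0.
Qed.

End Weight.
End Gap.
End Words.

(** * Rigidity and renormalization of affine self-embeddings *)

Section SelfEmbeddings.
Variables (R : realType) (l : nat) (lam a : 'I_l -> R) (K : set R).
Hypothesis lam_lt1 : is_ifs lam a.
Hypothesis K_attractor : is_attractor lam a K.
Hypothesis K_many : ~ is_singleton K.
Local Notation f := (ifs_map lam a).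
Local Notation word_map := (word_map lam a).
Local Notation word_ratio := (word_ratio lam).
Local Notation cylinder := (cylinder lam a K).

Variables delta D s : R.
Hypothesis delta_gt0 : 0 < delta.
Hypothesis gap : forall i j x y, i != j -> K x -> K y ->
  delta <= `|f i x - f j y|.
Hypothesis D_gt0 : 0 < D.
Hypothesis K_le : forall x, K x -> `|x| <= D.
Hypothesis s_gt0 : 0 < s.
Hypothesis moran : \sum_i `|lam i| `^ s = 1.
Local Notation weight := (weight lam s).
Local Notation total_weight := (total_weight lam s).
Local Notation covers := (covers lam a K).

Lemma D2_gt0 : 0 < 2 * D.
Proof. by rewrite mulr_gt0. Qed.

Lemma attractor_dist x y : K x -> K y -> `|x - y| <= 2 * D.
Proof.
move=> Kx Ky; apply: le_trans (ler_normB _ _) _.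
by have := K_le Kx; have := K_le Ky; lra.
Qed.

Lemma cylinder_dist w x y : cylinder w x -> cylinder w y ->
  `|x - y| <= `|word_ratio w| * (2 * D).
Proof.
move=> [u Ku <-] [v Kv <-]; rewrite word_mapB normrM ler_wpM2l //.
exact: attractor_dist.
Qed.

(** A map moving points by less than [delta] sends each first-level piece into
    itself.  The distance between the [n]-th iterates of points of two pieces is
    [|r|^n] times the initial distance and stays between [delta] and [2 D],
    which forces [|r| = 1].  A translation by [c <> 0] would have unbounded
    orbits, and a reflection cannot move two points at distance at least [delta]
    by less than [delta] each. *)
Lemma near_identity_rigid (r c : R) : (forall x, K x -> K (r * x + c)) ->
  (forall x, K x -> `|r * x + c - x| < delta) -> r = 1 /\ c = 0.
Proof.
move=> rcK near; pose T (z : R) := r * z + c.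
have [[x0 Kx0] _ _] := K_attractor.
have [i [j ij]] := two_letters lam_lt1 K_attractor K_many.
have orbit k n : exists2 u, K u & iter n T (f k x0) = f k u.
  elim: n => [|n [u Ku e]]; first by exists x0.
  rewrite iterS e.
  have Kfu : K (f k u) by exact: (ifs_map_in K_attractor).
  have [k' [v Kv ev]] := ifs_map_preimage K_attractor (rcK _ Kfu).
  exists v => //; rewrite /T -ev; congr (f _ v).
  by apply: (same_letter gap Kv Ku); rewrite ev; exact: near.
pose x := f i x0; pose y := f j x0.
have xy_dist n : delta <= `|r| ^+ n * `|x - y| <= 2 * D.
  have -> : `|r| ^+ n * `|x - y| = `|iter n T x - iter n T y|.
    elim: n => [|n IH]; first by rewrite mul1r.
    rewrite exprS -mulrA IH !iterS -normrM; congr `|_|; rewrite /T; ring.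
  have [u Ku eu] := orbit i n; have [v Kv ev] := orbit j n.
  rewrite /x /y eu ev gap //=; apply: attractor_dist;
    exact: (ifs_map_in K_attractor).
have xy0 : 0 < `|x - y|.
  by have := xy_dist 0%N; rewrite mul1r => /andP[h _]; exact: lt_le_trans h.
have r1 : `|r| = 1.
  have [r_lt1|r_gt1|//] := ltgtP `|r| 1.
    have [||n Hn] := @expr_lt_eps R `|r| (delta / `|x - y|).
    - by rewrite normr_ge0.
    - exact: divr_gt0.
    have := xy_dist n; move: Hn; rewrite ltr_pdivlMr // => h /andP[h' _].
    by have := lt_le_trans h h'; rewrite ltxx.
  have r0 : 0 < `|r| by lra.
  have [||n Hn] := @expr_lt_eps R `|r|^-1 (`|x - y| / (2 * D)).
  - by rewrite invr_ge0 normr_ge0 invf_lt1.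
  - by rewrite divr_gt0 ?D2_gt0.
  have := xy_dist n; move: Hn; rewrite ltr_pdivlMr ?D2_gt0 //.
  rewrite exprVn ltr_pdivrMl ?exprn_gt0 // => h /andP[_ h'].
  by have := lt_le_trans h h'; rewrite ltxx.
have Kx : K x by exact: (ifs_map_in K_attractor).
have Ky : K y by exact: (ifs_map_in K_attractor).
have /orP[/eqP re|/eqP re] : (r == 1) || (r == -1).
  by rewrite -eqr_norm2 r1 normr1.
  split=> //; apply/eqP/negPn/negP => c0.
  have iterE n : iter n T x = x + n%:R * c.
    elim: n => [|n IH]; first by rewrite mul0r addr0.
    by rewrite iterS IH /T re -natr1; ring.
  have c_gt0 : 0 < `|c| by rewrite normr_gt0.
  have := archi_boundP (divr_ge0 (ltW D2_gt0) (ltW c_gt0)).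
  set n := Num.bound _; rewrite ltr_pdivrMr // => Hn.
  have [u Ku eu] := orbit i n.
  have := attractor_dist (ifs_map_in K_attractor i Ku) Kx.
  rewrite -eu iterE addrC addKr normrM normr_nat => h.
  by have := lt_le_trans Hn h; rewrite ltxx.
exfalso.
have := near x Kx; have := near y Ky; have := gap ij Kx0 Kx0.
rewrite -/x -/y re !ltr_norml => + /andP[h1 h2] /andP[h3 h4].
have : `|x - y| < delta by rewrite ltr_norml; apply/andP; split; lra.
by move=> h h'; have := lt_le_trans h h'; rewrite ltxx.
Qed.

(** The preimage of a cylinder under an affine map lies in a single cylinder of
    comparable ratio, since it has comparable diameter. *)
Lemma affine_preimage_in_cylinder (r c : R) w : r != 0 ->
  exists2 v, (forall x, K x -> cylinder w (r * x + c) -> cylinder v x) &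
    `|word_ratio v| <= (2 * D + 1) / (delta * `|r|) * `|word_ratio w|.
Proof.
rewrite -normr_gt0 => r0.
have w0 := word_ratio_gt0 lam_lt1 w.
have [||x y [Kx wx] [Ky wy]|v Bv vr] := small_set_in_cylinder lam_lt1
  K_attractor delta_gt0 gap (B := [set x | K x /\ cylinder w (r * x + c)])
  (r := (2 * D + 1) / (delta * `|r|) * `|word_ratio w|).
- by move=> x [].
- by rewrite !mulr_gt0 ?invr_gt0 ?mulr_gt0 // addr_gt0 ?D2_gt0.
- have -> : delta * ((2 * D + 1) / (delta * `|r|) * `|word_ratio w|) =
      (2 * D + 1) * `|word_ratio w| / `|r|.
    by field; rewrite !gt_eqF.
  rewrite ltr_pdivlMr // mulrC -normrM.
  have -> : r * (x - y) = r * x + c - (r * y + c) by ring.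
  apply: le_lt_trans (cylinder_dist wx wy) _.
  by rewrite mulrC ltr_pM2r // ltrDl.
by exists v => // x Kx wx; apply: Bv.
Qed.

(** Pulling a cover of the image back to [K] changes each weight by at most a
    constant factor, and covers of [K] have weight at least one. *)
Lemma image_cover_weight (r c : R) : r != 0 -> exists2 kappa, 0 < kappa &
  forall S, covers S [set r * x + c | x in K] -> kappa <= total_weight S.
Proof.
move=> r0; set C := (2 * D + 1) / (delta * `|r|).
have C0 : 0 < C by rewrite divr_gt0 ?addr_gt0 ?mulr_gt0 ?normr_gt0.
have /choice[v Hv] : forall w, exists v,
    (forall x, K x -> cylinder w (r * x + c) -> cylinder v x) /\
    `|word_ratio v| <= C * `|word_ratio w|.
  by move=> w; have [v ? ?] := affine_preimage_in_cylinder c w r0; exists v.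
exists (C `^ s)^-1; first by rewrite invr_gt0 powR_gt0.
move=> S cov; rewrite -[leLHS]mulr1 ler_pdivrMl ?powR_gt0 //.
have cov' : covers (map v S) K.
  move=> x Kx; have [|w wS wx] := cov (r * x + c); first by exists x.
  by exists (v w); [exact: map_f|exact: (Hv w).1].
apply: le_trans (cover_weight_ge1 lam_lt1 K_attractor delta_gt0 gap moran cov') _.
rewrite /total_weight big_map mulr_sumr; apply: ler_sum => w _.
rewrite /weight -powRM //; last exact: ltW.
apply: ge0_ler_powR; [exact: ltW|by []|by rewrite nnegrE mulr_ge0 ?(ltW C0)|].
exact: (Hv w).2.
Qed.

Section OneEmbedding.
Variables r c : R.
Hypothesis r_neq0 : r != 0.
Hypothesis embeds : forall x, K x -> K (r * x + c).

(** Ratio and translation part of the map [f_I^-1 g f_J], for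
    [g(x) = r x + c]. *)
Definition renorm_ratio I J := r * word_ratio J / word_ratio I.
Definition renorm_shift I J :=
  (r * word_map J 0 + c - word_map I 0) / word_ratio I.

Lemma renormE I J x :
  word_map I (renorm_ratio I J * x + renorm_shift I J) = r * word_map J x + c.
Proof.
rewrite word_mapE (word_mapE _ _ J) /renorm_ratio /renorm_shift.
by field; exact: word_ratio_neq0 lam_lt1 I.
Qed.

(** The image of [K] under [f_I^-1 g f_J] lies in [f_I^-1(K)], in which [K] is
    isolated by the distance [delta]. *)
Lemma renorm_in I J x y : K x -> K y ->
  `|renorm_ratio I J * x + renorm_shift I J - y| < delta ->
  K (renorm_ratio I J * x + renorm_shift I J).
Proof.
move=> Kx Ky lt.
have IKy : cylinder I (word_map I y) by exists y.
have KJx : K (r * word_map J x + c).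
  by apply: embeds; exact: (word_map_in K_attractor).
have [|u Ku eu] :=
    cylinder_isolated lam_lt1 K_attractor delta_gt0 gap IKy KJx.
  rewrite -(renormE I) word_mapB normrM mulrC ltr_pM2r ?(word_ratio_gt0 lam_lt1) //.
  by rewrite distrC.
by move: eu; rewrite -(renormE I) => /(word_map_inj lam_lt1) <-.
Qed.

(** Suppose that no depth [L] works: for each [n] there is a word [I n] such that
    [g(K)] meets all subcylinders of depth [n] of [f_(I n)(K)].  The part of [K]
    sent by [g] into that cylinder lies in a single cylinder [J n] of comparable
    ratio, so the maps [h_n = f_(I n)^-1 g f_(J n)] have bounded coefficients
    and [h_n(K)] meets every cylinder of depth [n].  At a cluster point [h] of
    this sequence the image [h(K)] contains [K].  Then [h_n h^-1] sends [K] into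
    [K] and is close to the identity for some [n], so [h_n = h] by rigidity, and
    [f_(I n)(K)] lies in [g(K)]. *)
Lemma image_misses_cylinders :
  (forall I, ~ (cylinder I `<=` [set r * x + c | x in K])) ->
  exists L, forall I, exists2 J, size J = L &
    forall x, K x -> ~ cylinder (I ++ J) (r * x + c).
Proof.
move=> nowhere; apply: contrapT => noL.
have /choice[I HI] : forall n, exists I, forall J, size J = n ->
    exists2 x, K x & cylinder (I ++ J) (r * x + c).
  move=> n; apply: contrapT => nI; apply: noL; exists n => I.
  apply: contrapT => nJ; apply: nI; exists I => J Jn.
  apply: contrapT => nx; apply: nJ; exists J => // x Kx Jx.
  by apply: nx; exists x.
set C := (2 * D + 1) / (delta * `|r|).
have /choice[J HJ] : forall n, exists v,
    (forall x, K x -> cylinder (I n) (r * x + c) -> cylinder v x) /\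
    `|word_ratio v| <= C * `|word_ratio (I n)|.
  move=> n.
  by have [v ? ?] := affine_preimage_in_cylinder c (I n) r_neq0; exists v.
pose rho n := renorm_ratio (I n) (J n).
pose b n := renorm_shift (I n) (J n).
have hit n w : size w = n -> exists2 x, K x & cylinder w (rho n * x + b n).
  move=> wn; have [x0 Kx0 [u Ku]] := HI n w wn; rewrite word_map_cat => e.
  have Ix0 : cylinder (I n) (r * x0 + c).
    by rewrite -e; exists (word_map w u) => //; exact: (word_map_in K_attractor).
  have [x Kx xx0] := (HJ n).1 _ Kx0 Ix0.
  exists x => //; exists u => //; apply: (word_map_inj lam_lt1 (w := I n)).
  by rewrite e renormE xx0.
have rn0 : 0 < `|r| by rewrite normr_gt0.
have rho_le n : `|rho n| <= `|r| * C.
  rewrite /rho /renorm_ratio !normrM normfV ler_pdivrMr ?(word_ratio_gt0 lam_lt1) //.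
  by rewrite -mulrA ler_pM2l //; exact: (HJ n).2.
have [[p Kp] _ _] := K_attractor.
have b_le n : `|b n| <= D + `|r| * C * D.
  have [w wn _] := word_of_point K_attractor n Kp.
  have [x Kx /(cylinder_sub K_attractor) Khx] := hit n w wn.
  have -> : b n = (rho n * x + b n) - rho n * x by ring.
  apply: le_trans (ler_normB _ _) _; rewrite lerD ?K_le // normrM.
  by rewrite ler_pM // K_le.
(* h_n(K) meets two different first-level pieces, so h_n cannot contract much *)
have rho_ge n : delta <= `|rho n.+1| * (2 * D).
  have [i [j ij]] := two_letters lam_lt1 K_attractor K_many.
  have [w wn _] := word_of_point K_attractor n Kp.
  have [|x Kx [u Ku eu]] := hit n.+1 (i :: w); first by rewrite /= wn.
  have [|y Ky [v Kv ev]] := hit n.+1 (j :: w); first by rewrite /= wn.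
  have := gap ij (word_map_in K_attractor w Ku) (word_map_in K_attractor w Kv).
  rewrite -[f i _]/(word_map (i :: w) u) -[f j _]/(word_map (j :: w) v) eu ev.
  have -> : rho n.+1 * x + b n.+1 - (rho n.+1 * y + b n.+1) =
    rho n.+1 * (x - y) by ring.
  move/le_trans; apply; rewrite normrM ler_wpM2l //; exact: attractor_dist.
have rC0 : 0 <= `|r| * C by exact: le_trans (rho_le 0%N).
have rCD0 : 0 <= `|r| * C * D by rewrite mulr_ge0 // ltW.
have [||rh [bh lim]] :=
    @bounded_pair_cluster_point R rho b (D + `|r| * C * D + `|r| * C).
- by move=> n; apply: le_trans (rho_le n) _; rewrite lerDr addr_ge0 // ltW.
- by move=> n; apply: le_trans (b_le n) _; rewrite lerDl.
have rh0 : rh != 0.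
  apply/eqP => rh0.
  have [|[//|n] _ [+ _]] := lim (delta / (2 * D)) _ 1%N.
    by rewrite divr_gt0 ?D2_gt0.
  rewrite rh0 subr0 ltr_pdivlMr ?D2_gt0 //.
  by move=> h; have := lt_le_trans h (rho_ge n); rewrite ltxx.
have rhn0 : 0 < `|rh| by rewrite normr_gt0.
have close e : 0 < e -> forall N, exists2 n, (N <= n)%N &
    forall x, K x -> `|rho n * x + b n - (rh * x + bh)| < e.
  move=> e0 N; have D1 : 0 < D + 1 by rewrite addr_gt0.
  have [n Nn [h1 h2]] := lim (e / (D + 1)) (divr_gt0 e0 D1) N.
  exists n => // x Kx.
  have -> : rho n * x + b n - (rh * x + bh) = (rho n - rh) * x + (b n - bh)
    by ring.
  apply: le_lt_trans (ler_normD _ _) _; rewrite normrM.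
  have -> : e = e / (D + 1) * D + e / (D + 1) by field; rewrite gt_eqF.
  apply: ler_ltD => //; apply: ler_pM => //; first exact: ltW.
  exact: K_le.
(* K is contained in the image of K under the cluster map *)
have onto y : K y -> K ((y - bh) / rh).
  move=> Ky; apply: (attractor_closed K_attractor) => e e0.
  have [q /andP[q0 q1] lamq] := ratio_bound lam_lt1.
  have e20 : 0 < e * `|rh| / 2 by rewrite divr_gt0 // mulr_gt0.
  have [||N HN] := @expr_lt_eps R q (e * `|rh| / 2 / (2 * D)).
  - by rewrite q1 ltW.
  - by rewrite divr_gt0 ?D2_gt0.
  have [n Nn cl] := close _ e20 N.
  have [w wn wy] := word_of_point K_attractor n Ky.
  have [x Kx wx] := hit n w wn.
  exists x => //; rewrite -(ltr_pM2r rhn0) -normrM.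
  have -> : (x - (y - bh) / rh) * rh =
    (rho n * x + b n - y) - (rho n * x + b n - (rh * x + bh)) by field.
  apply: le_lt_trans (ler_normB _ _) _.
  have -> : e * `|rh| = e * `|rh| / 2 + e * `|rh| / 2 by field.
  apply: ler_ltD; last exact: cl.
  apply: le_trans (cylinder_dist wx wy) _.
  rewrite -ler_pdivlMr ?D2_gt0 //.
  apply: le_trans (word_ratio_le_expr w lamq) _; rewrite wn.
  apply: le_trans (ltW HN); apply: ler_wiXn2l => //; exact: ltW.
have [n _ cl] := close delta delta_gt0 0%N.
have clK y : K y -> `|rho n * ((y - bh) / rh) + b n - y| < delta.
  move=> Ky; have := cl _ (onto y Ky).
  by have -> : rh * ((y - bh) / rh) + bh = y by field.
have [||e1 e2] := @near_identity_rigid (rho n / rh) (b n - rho n * bh / rh).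
- move=> y Ky; have -> : rho n / rh * y + (b n - rho n * bh / rh) =
    rho n * ((y - bh) / rh) + b n by field.
  by apply: (renorm_in (onto y Ky) Ky); exact: clK.
- move=> y Ky; have -> : rho n / rh * y + (b n - rho n * bh / rh) =
    rho n * ((y - bh) / rh) + b n by field.
  exact: clK.
apply: (nowhere (I n)) => _ [y Ky <-].
exists (word_map (J n) ((y - bh) / rh)).
  by apply: (word_map_in K_attractor); exact: onto.
rewrite -(renormE (I n)) -/(rho n) -/(b n); congr (word_map _ _).
have -> : rho n * ((y - bh) / rh) + b n =
  rho n / rh * y + (b n - rho n * bh / rh) by field.
by rewrite e1 e2 mul1r addr0.
Qed.

End OneEmbedding.
End SelfEmbeddings.

(** * Images of self-embeddings contain cylinders *)

Section Interior.
Variables (R : realType) (l : nat) (lam a : 'I_l -> R) (K : set R).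
Hypothesis lam_lt1 : is_ifs lam a.
Hypothesis K_attractor : is_attractor lam a K.
Hypothesis K_many : ~ is_singleton K.
Hypothesis K_separated : trivIset setT (fun i => ifs_map lam a i @` K).
Local Notation f := (ifs_map lam a).
Local Notation word_map := (word_map lam a).
Local Notation word_ratio := (word_ratio lam).
Local Notation cylinder := (cylinder lam a K).

Section Shrinking.
Variable s : R.
Hypothesis moran : \sum_i `|lam i| `^ s = 1.
Local Notation weight := (weight lam s).
Local Notation total_weight := (total_weight lam s).

Lemma total_weight_prefix w S :
  total_weight [seq w ++ v | v <- S] = weight w * total_weight S.
Proof.
rewrite /total_weight big_map mulr_sumr.
by apply: eq_bigr => v _; exact: weight_cat.
Qed.

(** The complement of [f_J(K)] in [K] is the union of the siblings of the
    cylinders met on the way down to [J]; by Moran's equation, weight is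
    conserved at each of these steps. *)
Lemma siblings_cover J : exists2 S,
  (forall x, K x -> cylinder J x \/ exists2 w, w \in S & cylinder w x) &
  total_weight S = 1 - weight J.
Proof.
elim: J => [|i J [S cov tot]].
  exists [::]; last by rewrite /total_weight big_nil weight_nil subrr.
  by move=> x Kx; left; exists x.
exists ([seq [:: j] | j <- enum 'I_l & j != i] ++ [seq [:: i] ++ w | w <- S]).
  move=> x Kx; have [j [z Kz zx]] := ifs_map_preimage K_attractor Kx.
  have [ji|ji] := eqVneq j i; last first.
    right; exists [:: j]; last by exists z.
    by rewrite mem_cat map_f // mem_filter ji mem_enum.
  subst j; have [[t Kt tz]|[w wS [t Kt tz]]] := cov z Kz.
    by left; exists t => //=; rewrite tz.
  right; exists (i :: w); last by exists t => //=; rewrite tz.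
  by rewrite mem_cat (map_f (cat [:: i]) wS) orbT.
rewrite /total_weight big_cat -/(total_weight (map _ S)) total_weight_prefix tot.
rewrite !weight_cons weight_nil mulr1 big_map big_filter big_enum_cond /=.
rewrite -[X in _ = X - _]moran [in RHS](bigD1 i) //=.
rewrite [X in X + _ = _](eq_bigr (fun j => `|lam j| `^ s)); last first.
  by move=> j _; rewrite weight_cons weight_nil mulr1.
ring.
Qed.

(** If the image misses in each cylinder a subcylinder of relative weight at
    least [kappa], then covering that cylinder by the siblings of the missed one
    and iterating inside each of them saves a factor [1 - kappa] at each stage. *)
Lemma image_shrinks (r c kappa : R) (L : nat) : kappa <= 1 ->
  (forall J, size J = L -> kappa <= weight J) ->
  (forall I, exists2 J, size J = L &
     forall x, K x -> ~ cylinder (I ++ J) (r * x + c)) ->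
  forall n I, exists2 S,
    (forall x, K x -> cylinder I (r * x + c) ->
       exists2 w, w \in S & cylinder w (r * x + c)) &
    total_weight S <= weight I * (1 - kappa) ^+ n.
Proof.
move=> kappa1 kappaJ miss; elim=> [|n IH] I.
  exists [:: I]; last by rewrite /total_weight big_seq1 mulr1.
  by move=> x _ Ix; exists I; rewrite ?inE.
have [J JL IJ] := miss I.
have [S0 cov0 tot0] := siblings_cover J.
have /choice[S_ HS] : forall w, exists S,
    (forall x, K x -> cylinder (I ++ w) (r * x + c) ->
       exists2 v, v \in S & cylinder v (r * x + c)) /\
    total_weight S <= weight (I ++ w) * (1 - kappa) ^+ n.
  by move=> w; have [S ? ?] := IH (I ++ w); exists S.
exists (flatten [seq S_ w | w <- S0]).
  move=> x Kx [z Kz zx]; have [[t Kt tz]|[w wS [t Kt tz]]] := cov0 z Kz.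
    by case: (IJ x Kx); exists t => //; rewrite word_map_cat tz.
  have [|v vS vx] := (HS w).1 x Kx.
    by exists t => //; rewrite word_map_cat tz.
  by exists v => //; apply/flatten_mapP; exists w.
rewrite /total_weight big_flatten big_map /=.
apply: (@le_trans _ _ (\sum_(w <- S0) weight (I ++ w) * (1 - kappa) ^+ n)).
  by apply: ler_sum => w _; exact: (HS w).2.
rewrite -mulr_suml -(big_map (cat I) xpredT (fun w => weight w)).
rewrite -/(total_weight _) total_weight_prefix tot0 exprS mulrA.
rewrite ler_wpM2r ?exprn_ge0 ?subr_ge0 //.
rewrite ler_wpM2l ?weight_ge0 // lerD2l lerN2; exact: kappaJ.
Qed.

End Shrinking.

(** Otherwise the image would have covers of arbitrarily small weight. *)
Lemma self_embedding_interior (r c : R) : r != 0 ->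
  (forall x, K x -> K (r * x + c)) ->
  exists I, cylinder I `<=` [set r * x + c | x in K].
Proof.
move=> r0 rcK; apply: contrapT => noI.
have [delta delta0 gap] := gap_exists K_attractor K_separated.
have [D D0 K_le] := attractor_bound K_attractor.
have [i0 [j0 ij0]] := two_letters lam_lt1 K_attractor K_many.
have [s s0 moran] := similarity_dimension_exists ij0 lam_lt1.
have [|L miss] := image_misses_cylinders lam_lt1 K_attractor K_many delta0 gap
  D0 K_le r0 rcK.
  by move=> I HI; apply: noI; exists I.
have [kap kap0 Hkap] :=
  image_cover_weight lam_lt1 K_attractor delta0 gap D0 K_le s0 moran c r0.
have lams0 i : 0 < `|lam i| `^ s.
  by rewrite powR_gt0 //; have /andP[] := lam_lt1 i.
have [p /andP[p0 p1] Hp] := fin_pos_lower_bound lams0.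
have pJ J : size J = L -> p ^+ L <= weight lam s J.
  move=> <-; elim: J => [|i J IH]; first by rewrite weight_nil.
  by rewrite weight_cons exprS ler_pM // ?ltW // exprn_gt0.
have pL1 : p ^+ L <= 1 by rewrite exprn_ile1 // ltW.
have pL0 : 0 < p ^+ L by rewrite exprn_gt0.
have [|n Hn] := @expr_lt_eps R (1 - p ^+ L) kap _ kap0; first lra.
have [S cov tot] := image_shrinks moran pL1 pJ miss n [::].
have : kap <= total_weight lam s S.
  apply: Hkap => _ [x Kx <-]; apply: cov => //.
  by exists (r * x + c) => //; exact: rcK.
move/le_trans/(_ tot); rewrite weight_nil mul1r => h.
by have := le_lt_trans h Hn; rewrite ltxx.
Qed.

(** Two self-embeddings whose images contain [f_I(K)], and whose coefficients
    have a common rational approximation that is fine with respect to [I], are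
    equal by rigidity.  So the word and the approximations name the map. *)
Lemma self_embeddings_countable :
  countable [set g : R * R | g.1 != 0 /\ forall x, K x -> K (g.1 * x + g.2)].
Proof.
have [delta delta0 gap] := gap_exists K_attractor K_separated.
have [D D0 K_le] := attractor_bound K_attractor.
(* coefficients within e I give maps within delta * |I| on [-D, D] *)
pose e (I : seq 'I_l) := delta * `|word_ratio I| / (2 * (D + 1)).
have e0 I : 0 < e I.
  by rewrite divr_gt0 ?mulr_gt0 ?(word_ratio_gt0 lam_lt1) // addr_gt0.
have name (g : R * R) : exists d : seq 'I_l * rat * rat,
    g.1 != 0 /\ (forall x, K x -> K (g.1 * x + g.2)) ->
    [/\ cylinder d.1.1 `<=` [set g.1 * x + g.2 | x in K],
        ratr d.1.2 \in `]g.1 - e d.1.1 / 2, g.1 + e d.1.1 / 2[ &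
        ratr d.2 \in `]g.2 - e d.1.1 / 2, g.2 + e d.1.1 / 2[].
  have [[g0 gK]|ng] := pselect (g.1 != 0 /\ forall x, K x -> K (g.1 * x + g.2));
    last by exists ([::], 0, 0).
  have [I HI] := self_embedding_interior g0 gK.
  have e2 : 0 < e I / 2 by rewrite divr_gt0.
  have [q1 Hq1] : exists q : rat, ratr q \in `]g.1 - e I / 2, g.1 + e I / 2[.
    by apply: rat_in_itvoo; move: (e I / 2) e2 => y y0; lra.
  have [q2 Hq2] : exists q : rat, ratr q \in `]g.2 - e I / 2, g.2 + e I / 2[.
    by apply: rat_in_itvoo; move: (e I / 2) e2 => y y0; lra.
  by exists (I, q1, q2).
have [d Hd] := choice name.
apply/countable_injP; exists (fun g => pickle (d g)).
move=> g g'; rewrite !inE => -[g0 gK] [g'0 g'K] /(pcan_inj pickleK) dd.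
have [cyl] := Hd g (conj g0 gK); have [_] := Hd g' (conj g'0 g'K).
rewrite -dd; move: (d g) cyl => [[I q1] q2] /= cyl.
rewrite !in_itv /= => /andP[h1 h2] /andP[h3 h4] /andP[h5 h6] /andP[h7 h8].
have d1 : `|g'.1 - g.1| < e I by rewrite ltr_norml; apply/andP; split; lra.
have d2 : `|g'.2 - g.2| < e I by rewrite ltr_norml; apply/andP; split; lra.
have near x : K x ->
    `|g'.1 * x + g'.2 - (g.1 * x + g.2)| < delta * `|word_ratio I|.
  move=> Kx.
  have -> : g'.1 * x + g'.2 - (g.1 * x + g.2) =
    (g'.1 - g.1) * x + (g'.2 - g.2) by ring.
  apply: le_lt_trans (ler_normD _ _) _; rewrite normrM.
  have : `|g'.1 - g.1| * `|x| <= e I * D.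
    by apply: ler_pM => //; [exact: ltW|exact: K_le].
  have -> : delta * `|word_ratio I| = e I * D + e I + e I * (D + 1).
    by rewrite /e; field; rewrite gt_eqF // addr_gt0.
  have : 0 < e I * (D + 1) by rewrite mulr_gt0 // addr_gt0.
  move: d2; lra.
(* x |-> rho x + b is f_I^-1 g' g^-1 f_I, a self-embedding near the identity *)
have I0 := word_ratio_neq0 lam_lt1 I.
pose rho := g'.1 / g.1.
pose b := (rho * (word_map I 0 - g.2) + g'.2 - word_map I 0) / word_ratio I.
have psiE x z : g.1 * x + g.2 = word_map I z ->
    g'.1 * x + g'.2 = word_map I (rho * z + b).
  rewrite word_mapE (word_mapE _ _ I (rho * z + b)) => ez.
  have -> : x = (word_ratio I * z + word_map I 0 - g.2) / g.1.
    by rewrite -ez; field.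
  by rewrite /b /rho; field; apply/andP; split.
have [|z Kz|e1 e2] := @near_identity_rigid R l lam a K lam_lt1 K_attractor
    K_many delta D delta0 gap D0 K_le rho b.
- move=> z Kz; have [|x Kx ex] := cyl (word_map I z); first by exists z.
  have cz : cylinder I (g.1 * x + g.2) by rewrite ex; exists z.
  have [|t Kt et] := cylinder_isolated lam_lt1 K_attractor delta0 gap cz
    (g'K x Kx); first by rewrite distrC near.
  by move: et; rewrite (psiE x z ex) => /(word_map_inj lam_lt1) <-.
- have [|x Kx ex] := cyl (word_map I z); first by exists z.
  have := near x Kx; rewrite (psiE x z ex) ex word_mapB normrM mulrC.
  by rewrite ltr_pM2r ?(word_ratio_gt0 lam_lt1).
have r1 : g'.1 = g.1 by move: e1; rewrite /rho => /divr1_eq.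
have : b * word_ratio I = 0 by rewrite e2 mul0r.
rewrite /b e1 divfK // mul1r => h.
by rewrite [g]surjective_pairing [g']surjective_pairing r1; congr pair; lra.
Qed.

End Interior.

(** * Unions of translates *)

(** A finite form of Baire's theorem: if no cylinder lies in any [A k], one can
    shrink a cylinder successively so that it avoids every [A k].  The last
    hypothesis says that each [A k] is closed relatively to [K]. *)
Lemma cylinder_in_closed_piece (R : realType) (l : nat) (lam a : 'I_l -> R)
  (K : set R) (N : nat) (A : 'I_N -> set R) :
  is_ifs lam a -> is_attractor lam a K ->
  (forall x, K x -> exists k, A k x) ->
  (forall k x, K x -> ~ A k x ->
     exists2 e, 0 < e & forall y, K y -> `|y - x| < e -> ~ A k y) ->
  exists k w, cylinder lam a K w `<=` A k.
Proof.
move=> lam_lt1 K_att cov clo; apply: contrapT => no.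
have [D D0 K_le] := attractor_bound K_att.
have [q /andP[q0 q1] lamq] := ratio_bound lam_lt1.
suff [w miss] : exists w, forall k, k \in enum 'I_N ->
    forall x, cylinder lam a K w x -> ~ A k x.
  have [[x Kx] _ _] := K_att.
  have wx : cylinder lam a K w (word_map lam a w x) by exists x.
  have [k Akx] := cov _ (cylinder_sub K_att wx).
  by apply: (miss k _ _ wx Akx); rewrite mem_enum.
elim: (enum 'I_N) => [|k s [w miss]]; first by exists [::].
have [y [[x Kx <-] nAx]] : exists y, cylinder lam a K w y /\ ~ A k y.
  apply: contrapT => h; apply: no; exists k, w => y wy.
  by apply: contrapT => nA; apply: h; exists y.
have [e e0 He] := clo k _ (word_map_in K_att w Kx) nAx.
have D2 : 0 < 2 * D by rewrite mulr_gt0.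
have [||n Hn] := @expr_lt_eps R q (e / (2 * D)).
- by rewrite q1 ltW.
- exact: divr_gt0.
have [v vn [z Kz zx]] := word_of_point K_att n Kx.
exists (w ++ v) => k' k's z' vz'.
have wz' : cylinder lam a K w z'.
  case: vz' => u Ku <-; exists (word_map lam a v u); last by rewrite word_map_cat.
  exact: (word_map_in K_att).
move: k's; rewrite inE => /orP[/eqP ->|k's]; last exact: miss.
apply: He; first exact: (cylinder_sub K_att wz').
have vx : cylinder lam a K (w ++ v) (word_map lam a w x).
  by exists z => //; rewrite word_map_cat zx.
apply: le_lt_trans (cylinder_dist K_le vz' vx) _.
rewrite -ltr_pdivlMr //; apply: le_lt_trans Hn; rewrite -vn.
rewrite word_ratio_cat normrM -[leRHS]mul1r ler_pM //.
  by apply: le_trans (word_ratio_le_expr w lamq) _; rewrite exprn_ile1 // ltW.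
exact: word_ratio_le_expr.
Qed.

(** The difference [d] of two solutions satisfies [d (k j) = r * d j + const].
    Subtract the fixed point of [x |-> r x + const]: the result [e] satisfies
    [e (k j) = r * e j], and a nonzero entry of least absolute value would be
    followed by a smaller nonzero one. *)
Lemma translations_determined (R : realFieldType) (N : nat) (k : 'I_N -> 'I_N)
  (T T' : 'I_N -> R) (r b b' : R) : 0 < `|r| < 1 ->
  (forall j, r * T j + b - T (k j) = r * T' j + b' - T' (k j)) ->
  forall i j, T i - T' i = T j - T' j.
Proof.
move=> /andP[r0 r1] eqT.
have r1' : 1 - r != 0.
  by apply/eqP => h; move: r1; rewrite ltNge ler_normr; apply/negP/negPn; lra.
pose e j := T j - T' j - (b - b') / (1 - r).
have ek j : e (k j) = r * e j.
  have -> : e (k j) = r * (T j - T' j) + (b - b') - (b - b') / (1 - r).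
    by rewrite /e; have := eqT j; lra.
  by rewrite /e; field.
suff e0 j : e j = 0 by move=> i j; have := e0 i; have := e0 j; rewrite /e; lra.
apply/eqP/negPn/negP => ej.
case: (@arg_minP _ _ _ j (fun i => e i != 0) (fun i => `|e i|) ej) => i ei imin.
have : `|e i| <= `|e (k i)|.
  by apply: imin; rewrite ek mulf_neq0 // -normr_gt0.
by rewrite ek normrM leNgt gtr_pMl ?normr_gt0 // r1.
Qed.

Lemma countable_of_names (T : Type) (N : countType) (A : set T)
  (P : T -> N -> Prop) :
  (forall t, A t -> exists n, P t n) ->
  (forall t t' n, A t -> A t' -> P t n -> P t' n -> t = t') -> countable A.
Proof.
move=> names uniq_name; apply/countable_injP.
have [[n0]|noN] := pselect (inhabited N); last first.
  exists (fun=> 0%N) => t t'; rewrite inE => /names[n] _.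
  by case: noN.
have /choice[g Hg] : forall t, exists n, A t -> P t n.
  move=> t; have [/names[n Pn]|nA] := pselect (A t); first by exists n.
  by exists n0.
exists (pickle \o g) => t t'; rewrite !inE => At At' /(pcan_inj pickleK) e.
by apply: (uniq_name t t' (g t)) => //; [exact: Hg|rewrite e; exact: Hg].
Qed.

(* A tuple t lists t_1, ..., t_m, so the j-th entry of 0 :: t is t_j, with
   t_0 = 0. *)
Theorem theorem1p8 (R : realType) (K : set R) (m : nat)
  (K_ssc : self_similar_SSC K) (K_nonsingleton : ~ is_singleton K)
  (m_gt0 : (0 < m)%N) :
  countable [set t : m.-tuple R |
    (forall j : nat, (j < m)%N ->
       (0 :: (t : seq R))`_j < (0 :: (t : seq R))`_j.+1) /\
    self_similar (\bigcup_(j < m.+1) translate K (0 :: (t : seq R))`_j)].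
Proof.
have [l [lam [a [lam_lt1 K_att K_sep]]]] := K_ssc.
have /countable_injP[enc enc_inj] :=
  self_embeddings_countable lam_lt1 K_att K_nonsingleton K_sep.
set G := [set g | _] in enc_inj.
pose T (t : m.-tuple R) (j : 'I_m.+1) := (0 :: (t : seq R))`_j.
(* coefficients of x |-> r (f_w(x) + t_j) + b - t_k *)
pose phi (t : m.-tuple R) (r b : R) (j k : 'I_m.+1) (w : seq 'I_l) : R * R :=
  (r * word_ratio lam w, r * (word_map lam a w 0 + T t j) + b - T t k).
apply: (@countable_of_names _ {ffun 'I_m.+1 -> 'I_m.+1 * seq 'I_l * nat} _
  (fun t d => exists r b : R, 0 < `|r| < 1 /\ forall j,
     G (phi t r b j (d j).1.1 (d j).1.2) /\
     enc (phi t r b j (d j).1.1 (d j).1.2) = (d j).2)).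
  move=> t [_ [l' [lam' [a' [lam'_lt1 U_att]]]]].
  have [[u Uu] _ _] := U_att.
  have [i _] := ifs_map_preimage U_att Uu.
  have /andP[r0 r1] := lam'_lt1 i.
  have /choice[kw Hkw] : forall j, exists kw : 'I_m.+1 * seq 'I_l,
      G (phi t (lam' i) (a' i) j kw.1 kw.2).
    move=> j.
    have [||k [w kw]] := @cylinder_in_closed_piece R l lam a K m.+1
        (fun k => [set x | K (lam' i * (x + T t j) + a' i - T t k)]) lam_lt1 K_att.
    - move=> x Kx.
      have Ux : (\bigcup_(j < m.+1) translate K (0 :: (t : seq R))`_j) (x + T t j).
        by exists j => /=; [exact: ltn_ord|exists x].
      have [k /= km [y Ky yx]] := ifs_map_in U_att i Ux.
      by exists (Ordinal km); rewrite /= -[lam' i * _ + _]yx /T /= addrK.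
    - move=> k x Kx nA; apply: contrapT => h; apply: nA.
      apply: (attractor_closed K_att) => e e0; apply: contrapT => h'.
      apply: h; exists e => // y Ky yx Ay; apply: h'.
      exists (lam' i * (y + T t j) + a' i - T t k) => //.
      have -> : lam' i * (y + T t j) + a' i - T t k -
        (lam' i * (x + T t j) + a' i - T t k) = lam' i * (y - x) by ring.
      rewrite normrM; apply: le_lt_trans yx.
      by rewrite ler_piMl // ltW.
    exists (k, w); split.
      by rewrite /= mulf_neq0 // -normr_gt0 // (word_ratio_gt0 lam_lt1).
    move=> x Kx /=; have := kw (word_map lam a w x).
    rewrite /= word_mapE => H.
    have -> : lam' i * word_ratio lam w * x +
       (lam' i * (word_map lam a w 0 + T t j) + a' i - T t k) =
       lam' i * (word_ratio lam w * x + word_map lam a w 0 + T t j) + a' i - T t k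
       by ring.
    by apply: H; exists x => //; rewrite word_mapE.
  exists [ffun j => (kw j, enc (phi t (lam' i) (a' i) j (kw j).1 (kw j).2))].
  exists (lam' i), (a' i); split; first exact: lam'_lt1.
  by move=> j; rewrite ffunE.
move=> t t' d _ _ [r [b [r01 Ht]]] [r' [b' [_ Ht']]].
have eq_phi j : phi t r b j (d j).1.1 (d j).1.2 = phi t' r' b' j (d j).1.1 (d j).1.2.
  have [Gt et] := Ht j; have [Gt' et'] := Ht' j.
  by apply: enc_inj; rewrite ?inE // et et'.
have rr : r = r'.
  have := congr1 fst (eq_phi ord0) => /= /mulIf; apply.
  exact: word_ratio_neq0 lam_lt1 _.
subst r'.
have eqT j : r * T t j + b - T t (d j).1.1 = r * T t' j + b' - T t' (d j).1.1.
  by have := congr1 snd (eq_phi j); rewrite /phi /=; lra.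
have same j : T t j = T t' j.
  have := @translations_determined _ _ (fun j => (d j).1.1) _ _ _ _ _ r01 eqT j ord0.
  rewrite [T t ord0]/T [T t' ord0]/T /= subrr => /eqP.
  by rewrite subr_eq0 => /eqP.
apply: eq_from_tnth => i; rewrite !(tnth_nth 0).
by have := same (lift ord0 i); rewrite /T lift0.
Qed.
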